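(* Let $\lambda=(\lambda_{\overline2},\lambda_{\overline1})$ be a partition, i.e. $\lambda_{\overline2}\ge\lambda_{\overline1}\ge0$ are integers. 1. Regarding $\lambda$ as an element of $P^+_{C_2}$, $$K^{C_2}_{\lambda,0}(q)=\begin{cases} q^{\frac{\lambda_{\overline2}+\lambda_{\overline1}}2}\left(\dfrac{q^{\lambda_{\overline1}+2}-1}{q^2-1}+q^2\cdot\dfrac{q^{\lambda_{\overline1}+1}-1}{q-1}\cdot\dfrac{q^{\lambda_{\overline2}-\lambda_{\overline1}}-1}{q^2-1}\right)&\text{if }\lambda_{\overline2}\text{ and }\lambda_{\overline1}\text{ are even},\\[2mm] q^{\frac{\lambda_{\overline2}+\lambda_{\overline1}}2+1}\left(\dfrac{q^{\lambda_{\overline1}+1}-1}{q^2-1}+q\cdot\dfrac{q^{\lambda_{\overline1}+1}-1}{q-1}\cdot\dfrac{q^{\lambda_{\overline2}-\lambda_{\overline1}}-1}{q^2-1}\right)&\text{if }\lambda_{\overline2}\text{ and }\lambda_{\overline1}\text{ are odd},\\[2mm] 0&\text{otherwise.}\end{cases}$$ 2. Regarding $\lambda$ as an element of $P^+_{B_2}$, $$K^{B_2}_{\lambda,0}(q)=\begin{cases} q^{\lambda_{\overline2}}\left(\dfrac{q^{2\lambda_{\overline1}+2}-1}{q^2-1}+q^2\cdot\dfrac{q^{2\lambda_{\overline1}+1}-1}{q-1}\cdot\dfrac{q^{\lambda_{\overline2}-\lambda_{\overline1}}-1}{q^2-1}\right)&\text{if }\lambda_{\overline2}+\lambda_{\overline1}\text{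 is even},\\[2mm] q^{\lambda_{\overline2}+1}\cdot\dfrac{q^{2\lambda_{\overline1}+1}-1}{q-1}\cdot\dfrac{q^{\lambda_{\overline2}-\lambda_{\overline1}+1}-1}{q^2-1}&\text{otherwise.}\end{cases}$$
   Context: Write $\beta=(\beta_{\overline2},\beta_{\overline1})$ for $\beta_{\overline2}\varepsilon_{\overline2}+\beta_{\overline1}\varepsilon_{\overline1}$, with $\varepsilon_{\overline1},\varepsilon_{\overline2}$ an orthonormal basis of $\mathbb R^2$. The positive roots of $B_2$ ($so_5$) are $\varepsilon_{\overline2}\pm\varepsilon_{\overline1},\varepsilon_{\overline1},\varepsilon_{\overline2}$, with $\rho=(\frac32,\frac12)$; those of $C_2$ ($sp_4$) are $\varepsilon_{\overline2}\pm\varepsilon_{\overline1},2\varepsilon_{\overline1},2\varepsilon_{\overline2}$, with $\rho=(2,1)$. $P^+_{B_2}$ and $P^+_{C_2}$ denote the dominant weights. The Weyl group $W$ is the group of the $8$ signed permutations of the coordinates, with length $l$. The $q$-partition function is defined by $\prod_{\alpha\in R^+}\frac1{1-qx^\alpha}=\sum_\beta\mathcal P_q(\beta)x^\beta$ ($\mathcal P_q(\beta)=0$ if $\beta$ is not a nonnegative integral combination of positive roots), and $K_{\lambda,\mu}(q)=\sum_{\sigma\in W}(-1)^{l(\sigma)}\mathcal P_q(\sigma(\lambda+\rho)-(\mu+\rho))$. *)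

(* Defs.v *)
From mathcomp Require Import all_boot all_order all_algebra.
From mathcomp Require Import all_classical.

Set Implicit Arguments.
Unset Strict Implicit.
Unset Printing Implicit Defensive.

Import Order.TTheory GRing.Theory Num.Theory.
Local Open Scope classical_set_scope.
Local Open Scope ring_scope.

(* (b2, b1) : weight stands for b2 ε_2 + b1 ε_1.  All the roots and weights of
   B_2 and C_2 have rational coordinates. *)
Notation weight := (rat * rat)%type.

Definition posroots_B2 : seq weight :=
  [:: (1, 1); (1, -1); (0, 1); (1, 0)].
Definition rho_B2 : weight := (3 / 2, 1 / 2).

Definition posroots_C2 : seq weight :=
  [:: (1, 1); (1, -1); (0, 2); (2, 0)].
Definition rho_C2 : weight := (2, 1).

(* The indeterminate q is 'X : {poly int}, and f : series stands for the formal
   series \sum_b f(b) x^b. *)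
Definition series : Type := weight -> {poly int}.

Definition series1 : series := fun b => (b == 0)%:R.

(* A finitely supported sum: it is the usual product as soon as each x^b arises
   from finitely many pairs of monomials, which is the case for series supported
   on the cone spanned by the positive roots. *)
Definition series_mul (f g : series) : series :=
  fun b => \sum_(c \in [set: weight]) f c * g (b - c).

(* 1 / (1 - q x^a) = \sum_n q^n x^(n a) *)
Definition geom (a : weight) : series :=
  fun b => \sum_(n \in [set n : nat | a *+ n = b]) ('X^n : {poly int}).

Definition qpartition (posroots : seq weight) : series :=
  \big[series_mul/series1]_(a <- posroots) geom a.

(* The signed permutation (s, e2, e1) first exchanges the two coordinates if s
   holds, then changes the sign of coordinate 2 if e2 holds, and of coordinate 1
   if e1 holds. *)
Notation weyl := (bool * bool * bool)%type.

Definition weyl_act (w : weyl) (b : weight) : weight :=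
  let: (s, e2, e1) := w in
  let: (c2, c1) := if s then (b.2, b.1) else b in
  ((-1) ^+ e2 * c2, (-1) ^+ e1 * c1).

Definition weyl1 : weyl := (false, false, false).

Definition weyl_mul (v w : weyl) : weyl :=
  let: (s, e2, e1) := v in
  let: (t, f2, f1) := w in
  (s (+) t, e2 (+) (if s then f1 else f2), e1 (+) (if s then f2 else f1)).

Lemma weyl_act1 b : weyl_act weyl1 b = b.
Proof. by case: b => b2 b1; rewrite /weyl_act /= !mul1r. Qed.

Lemma weyl_actM v w b : weyl_act (weyl_mul v w) b = weyl_act v (weyl_act w b).
Proof.
case: v w b => [[s e2] e1] [[t f2] f1] [b2 b1].
by case: s; case: t; rewrite /weyl_act /= !signr_addb -!mulrA.
Qed.

(* The simple roots are ε_2 - ε_1 and ε_1 (resp. 2 ε_1), so the simple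
   reflections, hence the length, are the same for B_2 and C_2. *)
Definition simple_refl (i : bool) : weyl :=
  if i then (true, false, false) else (false, false, true).

Definition weyl_word (u : seq bool) : weyl :=
  \big[weyl_mul/weyl1]_(i <- u) simple_refl i.

Lemma weyl_word_exists (w : weyl) :
  exists n, [exists u : n.-tuple bool, weyl_word u == w].
Proof.
suff [u <-] : exists u, weyl_word u = w.
  by exists (size u); apply/existsP; exists (in_tuple u).
case: w => [[[] []] []];
  [ exists [:: false; true; false] | exists [:: true; false]
  | exists [:: false; true] | exists [:: true]
  | exists [:: true; false; true; false] | exists [:: true; false; true]
  | exists [:: false] | exists [::]];
  by rewrite /weyl_word !(big_cons, big_nil).
Qed.

Definition weyl_length (w : weyl) : nat := ex_minn (weyl_word_exists w).

Definition Kpoly (posroots : seq weight) (rho lambda mu : weight) : {poly int} :=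
  \sum_(w : weyl) (-1) ^+ weyl_length w
    * qpartition posroots (weyl_act w (lambda + rho) - (mu + rho)).

Definition K_B2 := Kpoly posroots_B2 rho_B2.
Definition K_C2 := Kpoly posroots_C2 rho_C2.

(* Main.v *)
Require Import Defs.
From mathcomp Require Import all_boot all_order all_algebra all_classical.
From mathcomp Require Import zify ring lra.
Import Order.TTheory GRing.Theory Num.Theory.
Local Open Scope ring_scope.

(* B_2 and C_2 are the cases k = 1 and k = 2 of the root system with positive
   roots (1, 1), (1, -1), (0, k), (k, 0).  Only three Weyl group elements move
   lambda + rho so that its difference with rho lies in the cone of the positive
   roots, hence
     K(x, y) = P(x, y) - P(x, -y - k) - P(y - 1, x + 1).
   Let P3 be the partition function of (1, 1), (1, -1), (0, k).  Dropping the root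
   (k, 0) from the first two terms and (0, k) from the last one, where nothing is
   left outside the cone x >= y, gives
     K(x, y) = q K(x - k, y) + P3(x, y) - P3(x, -y - k).
   P3 is a geometric sum, and the induction on x starts from K(y - 1, y) = 0 for
   k = 1, and from K(y - 1, y + 1) = - K(y, y) (a second induction) for k = 2. *)

(** * Heights of weights and convolution with a geometric series *)

(** A linear form positive on every positive root of both systems: it makes the convolution sums
    finite and serves as a decreasing measure. *)
Definition height (b : weight) : rat := 2 * b.1 + b.2.

Lemma heightD b c : height (b + c) = height b + height c.
Proof. by rewrite /height /=; ring. Qed.

Lemma heightB b c : height (b - c) = height b - height c.
Proof. by rewrite /height /=; ring. Qed.

Lemma height0 : height 0 = 0.
Proof. by rewrite -[0 in LHS](subrr 0) heightB subrr. Qed.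

Lemma heightMn b n : height (b *+ n) = height b *+ n.
Proof.
elim: n => [|n IHn]; first by rewrite !mulr0n height0.
by rewrite !mulrS heightD IHn.
Qed.

Lemma height_bound a b : 0 < height a -> exists n, height b < height a *+ n.
Proof.
move=> ha; exists (Num.bound `|height b / height a|).
rewrite -mulr_natl -ltr_pdivrMr// (le_lt_trans (ler_norm _))//.
by rewrite archi_boundP.
Qed.

Definition height_ge0 (f : series) := forall b, f b != 0 -> 0 <= height b.

(** The multiples of a have distinct heights, so [geom a] is ['X^n] at [a *+ n] and 0 elsewhere. *)
Lemma series_mul_geom a g b : 0 < height a ->
  series_mul (geom a) g b = \sum_(n \in [set: nat]) 'X^n * g (b - a *+ n).
Proof.
move=> ha; have ainj : injective (fun n => a *+ n).
  move=> m n /(congr1 height); rewrite !heightMn.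
  by apply: mulrIn; rewrite gt_eqF.
rewrite /series_mul -(@fsbig_widen _ _ _ _ (range (fun n => a *+ n))) //.
  rewrite fsbig_image; last by move=> m n _ _ /ainj.
  apply: eq_fsbigr => n _; congr (_ * _); rewrite /geom.
  rewrite (_ : [set _ | _] = [set n])%classic ?fsbig_set1//.
  by apply/seteqP; split => m /= [] => [/ainj|->].
move=> c [_ /= nc]; rewrite /preimage /= /geom fsbig1 ?mul0r// => n /= Hn.
by case: nc; exists n.
Qed.

(** From N on, the argument of g has negative height, so those terms vanish. *)
Lemma series_mul_geom_ord a g b N : 0 < height a -> height_ge0 g ->
    height b < height a *+ N ->
  series_mul (geom a) g b = \sum_(n < N) 'X^n * g (b - a *+ n).
Proof.
move=> ha hg hN; rewrite series_mul_geom//.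
rewrite (fsbig_ord _ _ (fun n => 'X^n * g (b - a *+ n))).
apply/esym/fsbig_widen => // n [_ /= /negP]; rewrite -leqNgt => Nn.
have [->|/hg] := eqVneq (g (b - a *+ n)) 0; first by rewrite mulr0.
rewrite heightB heightMn subr_ge0 leNgt (lt_le_trans hN)//.
by rewrite ler_wpMn2l// ltW.
Qed.

(** Coefficient form of (1 - q x^a) [geom a] = 1: the term n = 0 is split off. *)
Lemma series_mul_geom_rec a g b : 0 < height a -> height_ge0 g ->
  series_mul (geom a) g b = g b + 'X * series_mul (geom a) g (b - a).
Proof.
move=> ha hg; have [N hN] := height_bound _ (b - a) ha.
rewrite (series_mul_geom_ord _ _ b N.+1)// ?(series_mul_geom_ord _ _ (b - a) N)//.
  rewrite big_ord_recl expr0 mul1r mulr0n subr0 mulr_sumr; congr (_ + _).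
  by apply: eq_bigr => n _; rewrite lift0 exprS mulrS opprD addrA mulrA.
by rewrite mulrS -ltrBlDl -heightB.
Qed.

(** Each step by a lowers the height by a fixed positive amount, until both solutions vanish. *)
Lemma series_rec_unique a (f f' g : series) : 0 < height a ->
    height_ge0 f -> height_ge0 f' ->
    (forall b, f b = g b + 'X * f (b - a)) ->
    (forall b, f' b = g b + 'X * f' (b - a)) ->
  f =1 f'.
Proof.
move=> ha hf hf' rf rf' b.
have vanish f0 b0 : height_ge0 f0 -> height b0 < 0 -> f0 b0 = 0.
  by move=> h0 hb; apply/eqP; apply: contraTT hb => /h0; rewrite leNgt.
have [N hN] := height_bound _ b ha.
elim: N b hN => [|N IHN] b hN; first by rewrite !vanish.
by rewrite rf rf' IHN// heightB ltrBlDl -mulrS.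
Qed.

(** S is an additive submonoid; the instances below are half-planes and the lattice of even
    coordinate sum. *)
Lemma series_mul_supp (S : weight -> Prop) a g :
    S 0 -> S a -> (forall b c, S b -> S c -> S (b + c)) ->
    (forall b, g b != 0 -> S b) ->
  forall b, series_mul (geom a) g b != 0 -> S b.
Proof.
move=> S0 Sa SD Sg b.
move=> /(@fsbigN1 _ _ _ _ _ _ (fun b c => geom a c * g (b - c))).
case=> c _; rewrite mulf_eq0 negb_or => /andP[+ /Sg Sbc].
move=> /(@fsbigN1 _ _ _ unit _ _ (fun _ n => 'X^n) tt)[n /= nc _].
rewrite -(subrK c b); apply: (SD) => //; rewrite -nc.
by elim: n {nc} => [|n IHn]; rewrite ?mulr0n// mulrS; apply: SD.
Qed.

(** * Partition functions of lists of roots *)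

Lemma qpartition_nil b : qpartition [::] b = (b == 0)%:R.
Proof. by rewrite /qpartition big_nil. Qed.

Lemma qpartition_cons a rs :
  qpartition (a :: rs) = series_mul (geom a) (qpartition rs).
Proof. by rewrite /qpartition big_cons. Qed.

Lemma qpartition_supp (S : weight -> Prop) (rs : seq weight) :
    S 0 -> (forall b c, S b -> S c -> S (b + c)) -> {in rs, forall a, S a} ->
  forall b, qpartition rs b != 0 -> S b.
Proof.
move=> S0 SD; elim: rs => [_ b|a rs IHrs Srs b].
  by rewrite qpartition_nil; have [->|_] := eqVneq b 0; rewrite ?eqxx.
rewrite qpartition_cons; apply: series_mul_supp => //.
  by apply: Srs; rewrite mem_head.
by apply: IHrs => c crs; apply: Srs; rewrite inE crs orbT.
Qed.

Lemma qpartition_height_ge0 (rs : seq weight) :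
  {in rs, forall a, 0 < height a} -> height_ge0 (qpartition rs).
Proof.
move=> hrs; apply: qpartition_supp => [|b c hb hc|a /hrs /ltW//].
  by rewrite height0.
by rewrite heightD addr_ge0.
Qed.

(** Any factor of the product can be cleared, not only the first one: the exchange of factors comes
    from uniqueness of the recursion. *)
Lemma qpartition_rem a (rs : seq weight) b :
    {in rs, forall a, 0 < height a} -> a \in rs ->
  qpartition rs b = qpartition (rem a rs) b + 'X * qpartition rs (b - a).
Proof.
elim: rs b => // c rs IHrs b hrs; rewrite inE.
have hc : 0 < height c by apply: hrs; rewrite mem_head.
have {}hrs : {in rs, forall a, 0 < height a}.
  by move=> d drs; apply: hrs; rewrite inE drs orbT.
have h_rs := qpartition_height_ge0 _ hrs.
have [-> _|nac /= ars] := eqVneq a c.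
  by rewrite /= eqxx qpartition_cons -series_mul_geom_rec.
have ha := hrs a ars; rewrite eq_sym (negbTE nac) !qpartition_cons.
have hrem : height_ge0 (qpartition (rem a rs)).
  by apply: qpartition_height_ge0 => d /mem_rem /hrs.
have hmul g : height_ge0 g -> height_ge0 (series_mul (geom c) g).
  move=> hg; apply: series_mul_supp => //; rewrite ?height0 ?ltW//.
  by move=> ? ? ? ?; rewrite heightD addr_ge0.
(* Both sides solve the recursion of [series_mul (geom c) (qpartition (rem a rs))]. *)
apply/eqP; rewrite -subr_eq; apply/eqP.
set f := series_mul _ (qpartition rs).
apply: (@series_rec_unique c (fun b => f b - 'X * f (b - a)) _
  (qpartition (rem a rs))) => //.
- move=> d; have [fd|/(hmul _ h_rs)//] := eqVneq (f d) 0.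
  rewrite fd sub0r oppr_eq0 mulf_eq0 polyX_eq0 /= => /(hmul _ h_rs).
  by rewrite heightB subr_ge0 => /(le_trans (ltW ha)).
- exact: hmul.
- move=> d; rewrite /f (series_mul_geom_rec _ _ d hc h_rs) (IHrs d)//.
  rewrite (series_mul_geom_rec _ _ (d - a) hc h_rs).
  by rewrite (addrAC d); ring.
- by move=> d; apply: series_mul_geom_rec.
Qed.

Lemma qpartition_eq0 (u v : rat) (rs : seq weight) (x y : rat) :
    all (fun a => 0 <= u * a.1 + v * a.2) rs -> u * x + v * y < 0 ->
  qpartition rs (x, y) = 0.
Proof.
move=> /allP urs neg; apply/eqP; apply: contraTT neg => Pne0; rewrite -leNgt.
pose S (b : weight) := 0 <= u * b.1 + v * b.2.
apply: (@qpartition_supp S rs _ _ _ (x, y)) => //; first by rewrite /S /= !mulr0 addr0.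
by move=> b c; rewrite /S /=; lra.
Qed.

Lemma qpartition_odd (rs : seq weight) (x y : rat) :
    {in rs, forall a, exists z : int, a.1 + a.2 = 2 * z%:~R} ->
    (forall z : int, x + y != 2 * z%:~R) ->
  qpartition rs (x, y) = 0.
Proof.
move=> ers xy; apply/eqP/negP => /negP Pne0.
pose S (b : weight) := exists z : int, b.1 + b.2 = 2 * z%:~R.
suff: S (x, y) by case=> z /= /eqP; apply/negP.
apply: (@qpartition_supp S rs) => //; first by exists 0; rewrite /= mulr0 addr0.
move=> b c [z hz] [t ht]; exists (z + t); rewrite intrD mulrDr -hz -ht /=.
by rewrite addrACA.
Qed.

(** * The family of root systems and its recursions *)

Definition posroots (k : nat) : seq weight :=
  [:: (1, 1); (1, -1); (0, k%:R); (k%:R, 0)].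

(** Half the sum of [posroots k]. *)
Definition rho (k : nat) : weight := (k%:R / 2 + 1, k%:R / 2).

Definition P4 k (x y : rat) := qpartition (posroots k) (x, y).
Definition P3 (k : nat) (x y : rat) :=
  qpartition [:: (1, 1); (1, -1); (0, k%:R)] (x, y).
Definition P2 (x y : rat) := qpartition [:: (1, 1); (1, -1)] (x, y).

Section Recursions.

Variable k : nat.
Hypothesis k_gt0 : (0 < k)%N.

Lemma natk_gt0 : 0 < k%:R :> rat.
Proof. by rewrite ltr0n. Qed.

Lemma posroots_height : {in posroots k, forall a, 0 < height a}.
Proof.
have := natk_gt0; move=> hk a; rewrite !inE => /or4P[] /eqP->;
  by rewrite /height /=; lra.
Qed.

(** The cone of the positive roots has extreme rays (0, 1) and (1, -1), hence the two facets x = 0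
    and x + y = 0. *)
Lemma P4_eq0 x y : x < 0 \/ x + y < 0 -> P4 k x y = 0.
Proof.
have := natk_gt0; move=> hk [neg|neg].
  by apply: (@qpartition_eq0 1 0) => /=; lra.
by apply: (@qpartition_eq0 1 1) => /=; lra.
Qed.

Lemma P3_eq0 x y : x + y < 0 -> P3 k x y = 0.
Proof.
have := natk_gt0; move=> hk neg.
by apply: (@qpartition_eq0 1 1) => /=; lra.
Qed.

Lemma P4_rec x y : P4 k x y = P3 k x y + 'X * P4 k (x - k%:R) y.
Proof.
rewrite /P4 (qpartition_rem (k%:R, 0) _ _ posroots_height) ?inE ?eqxx ?orbT//.
have -> : (x, y) - (k%:R, 0) = (x - k%:R, y) :> weight.
  by congr (_, _); rewrite /= ?subr0.
by rewrite /= !xpair_eqE oppr_eq0 oner_eq0 (gt_eqF natk_gt0) !eqxx !andbF.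
Qed.

(** Once (0, k) is dropped, x - y is nonnegative on all remaining roots. *)
Lemma P4_recl x y : x < y -> P4 k x y = 'X * P4 k x (y - k%:R).
Proof.
move=> xy; have := natk_gt0; move=> hk.
rewrite /P4 (qpartition_rem (0, k%:R) _ _ posroots_height) ?inE ?eqxx ?orbT//.
have -> : (x, y) - (0, k%:R) = (x, y - k%:R) :> weight.
  by congr (_, _); rewrite /= ?subr0.
rewrite (@qpartition_eq0 1 (-1)) ?add0r//; last by lra.
by rewrite /= !xpair_eqE !(eq_sym _ 0) (lt_eqF natk_gt0) !eqxx /=; lra.
Qed.

Lemma P3_rec x y : P3 k x y = P2 x y + 'X * P3 k x (y - k%:R).
Proof.
rewrite /P3 (qpartition_rem (0, k%:R)) ?inE ?eqxx ?orbT//; last first.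
  move=> a ars; apply: posroots_height; move: ars.
  by rewrite !inE => /or3P[]->; rewrite ?orbT.
have -> : (x, y) - (0, k%:R) = (x, y - k%:R) :> weight.
  by congr (_, _); rewrite /= ?subr0.
by rewrite /= !xpair_eqE !(eq_sym _ 0) !eqxx.
Qed.

End Recursions.

(** * Closed forms for two and three roots *)

Lemma P2_odd (x y : rat) : (forall z : int, x + y != 2 * z%:~R) -> P2 x y = 0.
Proof.
apply: qpartition_odd => a; rewrite !inE => /orP[] /eqP->.
  by exists 1.
by exists 0.
Qed.

(** The only decomposition is i (1, 1) + (j - i) (1, -1), which uses j roots. *)
Lemma P2_even (i j : nat) : (i <= j)%N -> P2 j%:R (2 * i%:R - j%:R) = 'X^j.
Proof.
have h : {in [:: (1, 1); (1, -1)] : seq weight, forall a, 0 < height a}.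
  by move=> a; rewrite !inE => /orP[] /eqP->; rewrite /height /=.
have rec x y : P2 x y = qpartition [:: (1, -1)] (x, y) + 'X * P2 (x - 1) (y - 1).
  by rewrite /P2 (qpartition_rem (1, 1) _ _ h) ?inE ?eqxx.
have rec1 x y : qpartition [:: (1, -1)] (x, y)
    = ((x, y) == 0 :> weight)%:R + 'X * qpartition [:: (1, -1)] (x - 1, y + 1).
  rewrite (qpartition_rem (1, -1)) ?inE//=; last first.
    by move=> a; rewrite !inE => /eqP->; rewrite /height /=.
  rewrite qpartition_nil.
  have -> : (x, y) - (1, -1) = (x - 1, y + 1) :> weight; last by [].
  by congr (_, _); rewrite /= opprK.
have P1_diag n : qpartition [:: (1, -1)] (n%:R, - n%:R) = 'X^n.
  elim: n => [|n IHn]; rewrite rec1.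
    by rewrite (@qpartition_eq0 1 0)// mulr0 addr0 mulr0n oppr0 eqxx.
  rewrite -natr1 opprD addrNK addrK IHn -exprS natr1.
  by rewrite xpair_eqE pnatr_eq0 add0r.
elim: i j => [j _|i IHi [//|j] ij]; rewrite rec.
  by rewrite mulr0 add0r P1_diag /P2 (@qpartition_eq0 1 1) ?mulr0 ?addr0//; lra.
(* Multiples of (1, -1) have coordinate sum 0, while here the sum is positive. *)
rewrite (@qpartition_eq0 (-1) (-1)) ?add0r //=; last first.
  by rewrite -[i.+1%:R]natr1; have := ler0n rat i; lra.
rewrite exprS -(IHi j) //; congr (_ * P2 _ _).
  by rewrite -[j.+1%:R]natr1 addrK.
by rewrite -[j.+1%:R]natr1 -[i.+1%:R]natr1; ring.
Qed.

Lemma natr_odd (m : nat) (z : int) : odd m -> m%:R != 2 * z%:~R :> rat.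
Proof.
move=> om; apply/eqP => mz; have {mz} : m = 2 * z :> int.
  by apply: (@intr_inj rat); rewrite intrM.
by case: z => n; lia.
Qed.

(** Using (0, 1) r times leaves a [P2] term, equal to q^j when m - r is even and to 0 otherwise. So
    q^r is summed over the r <= m of the parity of m. *)
Lemma P3_B2 (m j : nat) : (m <= 2 * j)%N ->
  ('X^2 - 1) * P3 1 j%:R (m%:R - j%:R) = 'X^j * ('X^(m.+2) - 'X^(odd m)).
Proof.
elim: m => [_|m IHm mj]; rewrite P3_rec//.
  rewrite (P3_eq0 1) ?ltr01//; last by lra.
  have -> : 0%:R - j%:R = 2 * 0%:R - j%:R :> rat by rewrite mulr0.
  by rewrite P2_even// expr0; ring.
have -> : m.+1%:R - j%:R - 1%:R = m%:R - j%:R :> rat by rewrite -natr1; ring.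
rewrite mulrDr mulrCA IHm ?(ltnW mj)//=; case: (boolP (odd m)) => om /=.
  have -> : m.+1%:R = 2 * (m.+1./2)%:R :> rat.
    by rewrite -natrM mul2n even_halfK//= om.
  by rewrite P2_even ?leq_half_double; [rewrite !exprS; ring | lia].
rewrite P2_odd; first by rewrite !exprS; ring.
by move=> z; rewrite addrC subrK natr_odd.
Qed.

(** Each use of (0, 2) lowers m by one and keeps the parity, so every r <= m contributes q^(j +
    r). *)
Lemma P3_C2 (m j : nat) : (m <= j)%N ->
  ('X - 1) * P3 2 j%:R (2 * m%:R - j%:R) = 'X^j * ('X^(m.+1) - 1).
Proof.
elim: m => [_|m IHm mj]; rewrite P3_rec// P2_even//.
  by rewrite (P3_eq0 2)//; [ring | lra].
have -> : 2 * m.+1%:R - j%:R - 2%:R = 2 * m%:R - j%:R :> rat.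
  by rewrite -natr1; ring.
by rewrite mulrDr mulrCA IHm ?(ltnW mj)// !exprS; ring.
Qed.

(** * Recursion and closed forms for the three-term sum *)

(* The terms of the alternating sum which do not vanish for lambda = (x, y) dominant. *)
Definition K3 k (x y : rat) : {poly int} :=
  P4 k x y - P4 k x (- y - k%:R) - P4 k (y - 1) (x + 1).

Lemma K3_rec k x y : (0 < k)%N -> y < x + 2 ->
  K3 k x y = 'X * K3 k (x - k%:R) y + P3 k x y - P3 k x (- y - k%:R).
Proof.
move=> k0 yx; rewrite /K3 (P4_rec k k0 x y) (P4_rec k k0 x (- y - k%:R)).
rewrite (P4_recl k k0 (y - 1)); last by lra.
have -> : x + 1 - k%:R = x - k%:R + 1 by ring.
by ring.
Qed.

(** The rho-shifted exchange of coordinates sends (x, y) to (y - 1, x + 1) and swaps the outer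
    terms; the bounds put both middle terms outside the cone. *)
Lemma K3_anti k x y : (0 < k)%N -> x < y + k%:R -> y < x + k%:R + 2 ->
  K3 k x y = - K3 k (y - 1) (x + 1).
Proof.
move=> k0 xy yx; rewrite /K3 (P4_eq0 k k0 x (- y - k%:R)); last by right; lra.
rewrite (P4_eq0 k k0 (y - 1) (- (x + 1) - k%:R)); last by right; lra.
by rewrite addrK subrK; ring.
Qed.

Lemma K3_B2 (l n : nat) :
  ('X^2 - 1) * ('X - 1) * K3 1 (l + n)%:R l%:R =
  'X^(l + n) * (if odd n then 'X * ('X^(2 * l + 1) - 1) * ('X^(n + 1) - 1)
                else ('X^(2 * l + 2) - 1) * ('X - 1)
                     + 'X^2 * ('X^(2 * l + 1) - 1) * ('X^n - 1)).
Proof.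
(* The last [P3] stays unevaluated: [P3_B2] would apply to it with m - 1, and for m = 0 it vanishes
   instead. *)
have rec m : ('X^2 - 1) * ('X - 1) * K3 1 (l + m)%:R l%:R =
    'X * (('X^2 - 1) * ('X - 1) * K3 1 ((l + m)%:R - 1) l%:R)
    + ('X - 1) * ('X^(l + m) * ('X^((2 * l + m).+2) - 'X^(odd m)))
    - ('X - 1) * (('X^2 - 1) * P3 1 (l + m)%:R (- l%:R - 1)).
  rewrite K3_rec//; last by rewrite natrD; have := ler0n rat m; lra.
  have -> : odd m = odd (2 * l + m) by rewrite oddD mul2n odd_double.
  rewrite -P3_B2; last by lia.
  have -> : (2 * l + m)%:R - (l + m)%:R = l%:R :> rat by ring.
  by ring.
have exp2l : 'X^(2 * l) = 'X^l ^+ 2 :> {poly int} by rewrite mulnC exprM.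
elim: n => [|n IHn]; rewrite rec.
  (* The shifted exchange fixes (l - 1, l), so the outer terms cancel; the middle one has coordinate
     sum -2. *)
  have -> : K3 1 ((l + 0)%:R - 1) l%:R = 0.
    by rewrite addn0 /K3 subrK addrAC subrr add0r P4_eq0 ?oppr0//; right; lra.
  rewrite P3_eq0//; last by rewrite natrD; lra.
  by rewrite /= !addn0 !(exp2l, exprS, exprD); ring.
have -> : (l + n.+1)%:R - 1 = (l + n)%:R :> rat by rewrite addnS -natr1 addrK.
have -> : - l%:R - 1 = n%:R - (l + n.+1)%:R :> rat.
  by rewrite addnS -natr1 natrD; ring.
rewrite IHn P3_B2; last by lia.
by rewrite /=; case: (odd n) => /=; rewrite !(exp2l, exprS, exprD); ring.
Qed.

(** Since [K3_anti] relates (l - 1, l + 1) to (l, l), the recursion becomes K(l + 1, l + 1) = P3(l +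
    1, l + 1) - q K(l, l). The alternating sign brings in the parity of l. *)
Lemma K3_C2_diag (l : nat) :
  ('X^2 - 1) * ('X - 1) * K3 2 l%:R l%:R =
  'X^l * (if odd l then 'X * ('X^(l + 1) - 1) else 'X^(l + 2) - 1) * ('X - 1).
Proof.
have rec m : ('X^2 - 1) * ('X - 1) * K3 2 m%:R m%:R =
    'X * (('X^2 - 1) * ('X - 1) * K3 2 (m%:R - 2) m%:R)
    + ('X^2 - 1) * ('X^m * ('X^(m.+1) - 1)).
  rewrite K3_rec//; last by lra.
  rewrite (@P3_eq0 2 isT _ (- _ - _)); last by lra.
  rewrite -P3_C2//; have -> : 2 * m%:R - m%:R = m%:R :> rat by ring.
  by ring.
elim: l => [|l IHl]; rewrite rec.
  by rewrite /K3 !P4_eq0//=; [ring | left; lra..].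
rewrite K3_anti//; [|lra|lra].
have -> : l.+1%:R - 1 = l%:R :> rat by rewrite -natr1 addrK.
have -> : l.+1%:R - 2 + 1 = l%:R :> rat by rewrite -natr1; ring.
rewrite mulrN IHl /=.
by case: (odd l) => /=; rewrite !(exprS, exprD); ring.
Qed.

Lemma K3_C2 (l n : nat) :
  ('X^2 - 1) * ('X - 1) * K3 2 (l + 2 * n)%:R l%:R =
  if odd l then
    'X^(l + n + 1) * (('X^(l + 1) - 1) * ('X - 1)
                      + 'X * ('X^(l + 1) - 1) * ('X^(2 * n) - 1))
  else
    'X^(l + n) * (('X^(l + 2) - 1) * ('X - 1)
                  + 'X^2 * ('X^(l + 1) - 1) * ('X^(2 * n) - 1)).
Proof.
elim: n => [|n IHn].
  rewrite muln0 !addn0 K3_C2_diag.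
  by case: (odd l); rewrite !(exprS, exprD); ring.
rewrite K3_rec//; last by rewrite natrD; have := ler0n rat (2 * n.+1); lra.
have -> : (l + 2 * n.+1)%:R - 2 = (l + 2 * n)%:R :> rat.
  by ring.
set x : rat := (l + 2 * n.+1)%:R.
have -> : - l%:R - 2%:R = 2 * n%:R - x.
  by rewrite /x; ring.
have ex : l%:R = 2 * (l + n.+1)%:R - x.
  by rewrite /x; ring.
(* With j = x, the second coordinates l and -l - 2 have the form 2 m - j for m = l + n + 1 and m =
   n. *)
have h1 := @P3_C2 (l + n.+1) (l + 2 * n.+1) ltac:(lia).
have h2 := @P3_C2 n (l + 2 * n.+1) ltac:(lia).
rewrite -/x -ex in h1 h2; rewrite mulrBr mulrDr mulrCA IHn.
rewrite -![('X^2 - 1) * ('X - 1) * P3 _ _ _]mulrA h1 h2.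
have exp2 : 'X^(2 * n.+1) = 'X^2 * 'X^n ^+ 2 :> {poly int}.
  by rewrite mulnS exprD mulnC exprM.
have exp2n : 'X^(2 * n) = 'X^n ^+ 2 :> {poly int} by rewrite mulnC exprM.
by case: (odd l); rewrite !(exp2, exp2n, exprS, exprD); ring.
Qed.

(** * Reduction of the Weyl group sum to three terms *)

Lemma weyl_length1 : weyl_length weyl1 = 0%N.
Proof.
rewrite /weyl_length; case: ex_minnP => n _ min_n; apply/eqP; rewrite -leqn0 min_n//.
by apply/existsP; exists [tuple]; rewrite /weyl_word big_nil.
Qed.

Lemma weyl_length_simple i : weyl_length (simple_refl i) = 1%N.
Proof.
rewrite /weyl_length; case: ex_minnP => n /existsP[u uw] min_n.
have : (n <= 1)%N.
  apply: min_n; apply/existsP; exists [tuple i].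
  by rewrite /weyl_word big_cons big_nil; case: i {uw}.
case: n u uw {min_n} => [u|[]//]; rewrite tuple0 /weyl_word big_nil.
by case: i.
Qed.

(** A sign change on coordinate 2 makes that coordinate negative; the exchange followed by a sign
    change on coordinate 1 makes the coordinate sum negative. What survives is the identity and the
    two simple reflections. *)
Lemma Kpoly_K3 (k l2 l1 : nat) : (0 < k)%N -> (l1 <= l2)%N ->
  Kpoly (posroots k) (rho k) (l2%:R, l1%:R) 0 = K3 k l2%:R l1%:R.
Proof.
move=> k0; rewrite -(ler_nat rat) => l12.
have l1_ge0 := ler0n rat l1; have hk := natk_gt0 _ k0.
pose Q w := qpartition (posroots k)
  (weyl_act w ((l2%:R, l1%:R) + rho k) - (0 + rho k)).
have Q_neg2 s e1 : Q (s, true, e1) = 0.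
  by case: s; apply: P4_eq0 => //; left; rewrite /= expr1; lra.
have Q_neg12 : Q (true, false, true) = 0.
  by apply: P4_eq0 => //; right; rewrite /= expr1 expr0; lra.
have Q1 : Q weyl1 = P4 k l2%:R l1%:R.
  by rewrite /Q weyl_act1 add0r addrK.
have Qs1 : Q (simple_refl false) = P4 k l2%:R (- l1%:R - k%:R).
  by congr (qpartition _ (_, _)); rewrite /= ?expr0 ?expr1; field.
have Qs2 : Q (simple_refl true) = P4 k (l1%:R - 1) (l2%:R + 1).
  by congr (qpartition _ (_, _)); rewrite /= ?expr0 ?expr1; field.
pose f s e2 e1 : {poly int} := (-1) ^+ weyl_length (s, e2, e1) * Q (s, e2, e1).
have -> : Kpoly (posroots k) (rho k) (l2%:R, l1%:R) 0
    = \sum_(s : bool) \sum_(e2 : bool) \sum_(e1 : bool) f s e2 e1.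
  rewrite (pair_bigA _ (fun s e2 => \sum_(e1 : bool) f s e2 e1)) /=.
  rewrite (pair_bigA _ (fun p e1 => f p.1 p.2 e1)) /=.
  by apply: eq_bigr => -[[s e2] e1] _.
rewrite !big_bool /f !Q_neg2 Q_neg12 -/weyl1 -/(simple_refl true) -/(simple_refl false).
rewrite !weyl_length_simple weyl_length1 Q1 Qs1 Qs2 /K3.
by rewrite expr0 expr1 !mulr0 /=; ring.
Qed.

(** All roots of C_2 have even coordinate sum, whereas the three arguments of [P4] have odd sum. *)
Lemma K3_C2_odd (l2 l1 : nat) : odd (l2 + l1) -> K3 2 l2%:R l1%:R = 0.
Proof.
move=> o; have P4_odd x y : (forall z : int, x + y != 2 * z%:~R) -> P4 2 x y = 0.
  apply: qpartition_odd => a; rewrite !inE => /or4P[] /eqP-> /=.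
  - by exists 1.
  - by exists 0.
  - by exists 1.
  - by exists 1.
have odd_l z : l2%:R + l1%:R != 2 * z%:~R :> rat by rewrite -natrD natr_odd.
rewrite /K3 !P4_odd ?subrr// => z.
- by apply: contra (odd_l z) => /eqP <-; apply/eqP; ring.
- apply: contra (odd_l (z + l1%:Z + 1)) => /eqP h; apply/eqP.
  by rewrite !intrD !mulrDr -h /= -[l1%:Z%:~R]/(l1%:R : rat); ring.
Qed.

(** * Division by the cleared denominators and conclusion *)

(** Applied with x = q^2 - 1 and y = q - 1 to the images of the polynomial identities in the
    fraction field. *)
Lemma eq_add_fractions (F : fieldType) (x y K u a b c d : F) : x != 0 -> y != 0 ->
  x * y * K = u * (a * y + c * b * d) -> K = u * (a / x + c * (b / y) * (d / x)).
Proof.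
by move=> x0 y0 KE; apply: (mulfI (mulf_neq0 x0 y0)); rewrite KE; field; apply/andP.
Qed.

Lemma eq_mul_fractions (F : fieldType) (x y K u v b d : F) : x != 0 -> y != 0 ->
  x * y * K = u * (v * b * d) -> K = u * v * (b / y) * (d / x).
Proof.
by move=> x0 y0 KE; apply: (mulfI (mulf_neq0 x0 y0)); rewrite KE; field; apply/andP.
Qed.

Theorem proposition5p2p1 (l2 l1 : nat) (hl : (l1 <= l2)%N) :
  let lambda : weight := (l2%:R, l1%:R) in
  let q : {fraction {poly int}} := tofrac 'X in
  tofrac (K_C2 lambda 0) =
    (if ~~ odd l2 && ~~ odd l1 then
       q ^+ ((l2 + l1) %/ 2)
       * ((q ^+ (l1 + 2) - 1) / (q ^+ 2 - 1)
          + q ^+ 2 * ((q ^+ (l1 + 1) - 1) / (q - 1))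
                   * ((q ^+ (l2 - l1) - 1) / (q ^+ 2 - 1)))
     else if odd l2 && odd l1 then
       q ^+ ((l2 + l1) %/ 2 + 1)
       * ((q ^+ (l1 + 1) - 1) / (q ^+ 2 - 1)
          + q * ((q ^+ (l1 + 1) - 1) / (q - 1))
              * ((q ^+ (l2 - l1) - 1) / (q ^+ 2 - 1)))
     else 0)
  /\
  tofrac (K_B2 lambda 0) =
    (if ~~ odd (l2 + l1) then
       q ^+ l2
       * ((q ^+ (2 * l1 + 2) - 1) / (q ^+ 2 - 1)
          + q ^+ 2 * ((q ^+ (2 * l1 + 1) - 1) / (q - 1))
                   * ((q ^+ (l2 - l1) - 1) / (q ^+ 2 - 1)))
     else
       q ^+ (l2 + 1)
       * ((q ^+ (2 * l1 + 1) - 1) / (q - 1))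
       * ((q ^+ (l2 - l1 + 1) - 1) / (q ^+ 2 - 1))).
Proof.
move=> lambda q.
(* The roots and rho of C_2 agree with [posroots 2] and [rho 2] by computation on rationals;
   likewise for B_2 with k = 1. *)
have K_C2E : K_C2 lambda 0 = K3 2 l2%:R l1%:R by rewrite -Kpoly_K3.
have K_B2E : K_B2 lambda 0 = K3 1 l2%:R l1%:R by rewrite -Kpoly_K3.
have q1 : q - 1 != 0.
  by rewrite -tofrac1 -tofracB tofrac_eq0 polyXsubC_eq0.
have q2 : q ^+ 2 - 1 != 0.
  rewrite -tofrac1 -tofracXn -tofracB tofrac_eq0.
  by rewrite -(@size_poly_eq0 int) size_XnsubC.
pose tofracE := (tofracM, tofracB, tofracD, tofracXn, tofrac1).
rewrite K_C2E K_B2E {K_C2E K_B2E lambda}.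
have [n -> {hl l2}] : exists n, l2 = (l1 + n)%N.
  by exists (l2 - l1)%N; rewrite subnKC.
rewrite addKn; split.
  (* For odd n the coordinates have different parities, which is the zero case. *)
  case: (boolP (odd n)) => on.
    rewrite K3_C2_odd ?tofrac0 ?oddD ?on; last by case: (odd l1).
    by case: (odd l1).
  have [m -> {n on}] : exists m, n = (2 * m)%N.
    by exists n./2; rewrite mul2n even_halfK.
  have -> : ((l1 + 2 * m + l1) %/ 2 = l1 + m)%N by lia.
  have -> : odd (l1 + 2 * m) = odd l1 by rewrite oddD mul2n odd_double addbF.
  rewrite andbb if_neg andbb; have /(congr1 (@tofrac _)) := K3_C2 l1 m.
  by case: (odd l1); rewrite !tofracE -/q => /(eq_add_fractions _ _ _ _ _ _ _ _ _ q2 q1).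
have -> : odd (l1 + n + l1) = odd n by lia.
rewrite if_neg; have /(congr1 (@tofrac _)) := K3_B2 l1 n.
case: (odd n); rewrite !tofracE -/q.
  by rewrite [q ^+ (_ + n + 1)]exprD => /(eq_mul_fractions _ _ _ _ _ _ _ _ q2 q1).
by move=> /(eq_add_fractions _ _ _ _ _ _ _ _ _ q2 q1).
Qed.
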